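(* Let $H$ be a fixed finite graph with degeneracy $d\ge 2$ and depth $\Delta\ge 1$. Then, as $p\to 0$, $$f(H,p)=O_H\!\left(\frac{p^{-d}\,\log_{\Delta+1}(p^{-1})}{\log_{\Delta}(p^{-1})}\right),$$ where the implicit constant depends only on $H$.
   Context: Subgraph query problem: $G\sim G(\infty,p)$ is the Erdős–Rényi random graph on a countably infinite vertex set, each pair being an edge independently with probability $p\in(0,1)$. A querying strategy adaptively asks queries of the form ''is $(u,v)\in E(G)$?'', each query being allowed to depend on the answers to the previous ones. A copy of $H$ is found when all edges of some copy of $H$ in $G$ have been queried (and answered positively). $f(H,p)$ is the smallest number of queries for which some strategy finds a copy of $H$ in $G(\infty,p)$ with probability at least $\tfrac12$. A graph is $d$-degenerate if every subgraph of it contains a vertex of degree at most $d$; equivalently, it has an acyclic orientation with maximum outdegree at most $d$. The degeneracy of $H$ is the least $d$ for which $H$ is $d$-degenerate. The depth $\Delta$ of a graph $H$ with degeneracy $d$ is the smallest $\Delta$ for which there exists an acyclic orientation of $H$ with maximum outdegree at most $d$ in which every directed path has length at most $\Delta$ (length is the number of edges). $\log$ is the natural logarithm and $\log_t(x)$ denotes the $t$-fold iterated natural logarithm of $x$ (so $\log_1 x=\log x$, $\log_2 x=\log\log x$, etc.). *)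

(* Defs.v *)
From HB Require Import structures.
From mathcomp Require Import all_boot all_order all_algebra.
From mathcomp Require Import all_classical all_reals all_analysis.
Import Order.TTheory GRing.Theory Num.Theory.
Import numFieldNormedType.Exports.

Set Implicit Arguments.
Unset Strict Implicit.
Unset Printing Implicit Defensive.

Local Open Scope classical_set_scope.
Local Open Scope ring_scope.

Definition is_least (Q : nat -> Prop) (n : nat) : Prop :=
  Q n /\ forall m : nat, Q m -> (n <= m)%N.

Definition simple_graph (V : Type) (e : rel V) : Prop :=
  symmetric e /\ irreflexive e.

Section FiniteGraph.
Variables (V : finType) (e : rel V).

(* A subgraph has vertex set W and adjacency F restricted to W; it need not be
   induced. *)
Definition degenerate (k : nat) : Prop :=
  forall (W : {set V}) (F : rel V),
    W != finset.set0 -> symmetric F -> subrel F e ->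
    exists2 x : V, x \in W & (#|[set y in W | F x y]%SET| <= k)%N.

Definition is_degeneracy (k : nat) : Prop := is_least degenerate k.

Definition orientation (O : rel V) : Prop :=
  subrel O e /\ forall x y : V, e x y -> O x y (+) O y x.

Definition acyclic (O : rel V) : Prop :=
  forall c : seq V, cycle O c -> c = [::].

Definition max_outdegree_le (O : rel V) (k : nat) : Prop :=
  forall x : V, (#|[set y | O x y]%SET| <= k)%N.

(* The directed path x :: s has size s edges. *)
Definition directed_paths_le (O : rel V) (l : nat) : Prop :=
  forall (x : V) (s : seq V), path O x s -> uniq (x :: s) -> (size s <= l)%N.

(* To be used with k the degeneracy of e. *)
Definition is_depth (k l : nat) : Prop :=
  is_least (fun m => exists O : rel V,
    [/\ orientation O, acyclic O, max_outdegree_le O k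
      & directed_paths_le O m]) l.

End FiniteGraph.

(* A list of queried pairs together with the answers, oldest query first. *)
Definition history := seq ((nat * nat) * bool).

Definition strategy := history -> nat * nat.

Fixpoint transcript (s : strategy) (g : rel nat) (n : nat) : history :=
  if n is m.+1 then
    let h := transcript s g m in rcons h (s h, g (s h).1 (s h).2)
  else [::].

(* phi embeds the graph e as a copy all of whose edges were queried, in either
   order of the endpoints, and answered positively. *)
Definition copy_found (V : finType) (e : rel V) (h : history) : Prop :=
  exists phi : V -> nat, injective phi /\
    forall x y : V, e x y ->
      ((phi x, phi y), true) \in h \/ ((phi y, phi x), true) \in h.

Section RandomGraph.
Context {R : realType} {disp : measure_display} {T : measurableType disp}.
Variables (P : probability T R) (G : T -> rel nat).

Definition edge_event (u v : nat) : set T := [set w | G w u v].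

(* G is an Erdos-Renyi random graph with edge probability p on the vertex set
   nat.  Unordered pairs of vertices are represented by (u, v) with u < v. *)
Definition erdos_renyi (p : R) : Prop :=
  [/\ forall w : T, simple_graph (G w),
      forall u v : nat, measurable (edge_event u v),
      forall u v : nat, u != v -> P (edge_event u v) = p%:E
    & forall s : seq (nat * nat),
        uniq s -> all (fun uv => (uv.1 < uv.2)%N) s ->
        P [set w | forall uv, uv \in s -> edge_event uv.1 uv.2 w] =
        (\prod_(uv <- s) P (edge_event uv.1 uv.2))%E ].

Definition finds_with_half (V : finType) (e : rel V) (n : nat) : Prop :=
  exists s : strategy,
    ((2^-1 : R)%:E <= P [set w | copy_found e (transcript s (G w) n)])%E.

(* Extended-real valued, so that it is +oo when no number of queries works. *)
Definition query_number (V : finType) (e : rel V) : \bar R :=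
  ereal_inf [set (n%:R : R)%:E | n in finds_with_half e].

End RandomGraph.

(* Iterated natural logarithm; ln x = 0 for x <= 0, which does not occur for
   large x. *)
Definition iter_log {R : realType} (t : nat) (x : R) : R := iter t (@ln R) x.

(* Main.v *)
Require Import Defs.
From HB Require Import structures.
From mathcomp Require Import all_boot all_order all_algebra.
From mathcomp Require Import all_classical all_reals all_analysis.
From mathcomp Require Import zify ring lra.
Import Order.TTheory GRing.Theory Num.Theory.
Import numFieldNormedType.Exports.

(* Fix an acyclic orientation of H with outdegrees at most d and longest path
   Delta; it splits H into levels 0, ..., Delta with every arc going down.  The
   vertices are placed from the lowest level up, each w drawing its image from
   its own pool of about p^-k / K fresh vertices, k being its outdegree.  When
   an out-neighbour of w is placed, the pool is filtered by adjacency to its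
   image.  Until the last out-neighbour this loses a factor p and fails with
   small probability; before the last one about p^-1 / K candidates are left,
   so a random image of the last out-neighbour u is adjacent to only 1 / K of
   them on average.  But u itself has M_i candidates, i being its level, and
   if M_i is at least about (4 K M_(i+1))^(n M_(i+1)) then with high
   probability some candidate is adjacent to M_(i+1) remaining candidates of
   each w waiting for u.  Starting from M_Delta = 1 this makes M_0 a tower of
   exponentials of height Delta in K, which stays below the square root of
   p^-1 for K about log_Delta (p^-1).  All of this costs O(p^-d / K) queries. *)

Set Implicit Arguments.
Unset Strict Implicit.
Unset Printing Implicit Defensive.

Local Open Scope classical_set_scope.
Local Open Scope ring_scope.

(** * Strategies made of rounds of queries *)

Section QueryRounds.

Definition answer (g : rel nat) (q : nat * nat) : bool := g q.1 q.2.

Definition agree (D : seq (nat * nat)) (g g' : rel nat) : Prop :=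
  {in D, answer g =1 answer g'}.

Lemma agree_sub (D D' : seq (nat * nat)) (g g' : rel nat) :
  {subset D' <= D} -> agree D g g' -> agree D' g g'.
Proof. by move=> sub a q /sub /a. Qed.

Definition graph_of (h : history) : rel nat := fun u v => ((u, v), true) \in h.

(** Query [n] depends only on the answers to the first [n] queries, so a query list that reads the
    whole graph can be run as a strategy: the history fixes as much of the graph as the next query
    needs, and [graph_of] fills the rest with non-edges. *)
Definition nonanticipating (A : rel nat -> seq (nat * nat)) : Prop :=
  forall (g g' : rel nat) (n : nat), agree (take n (A g)) g g' ->
    nth (0%N, 0%N) (A g) n = nth (0%N, 0%N) (A g') n.

Definition strategy_of (A : rel nat -> seq (nat * nat)) : strategy :=
  fun h => nth (0%N, 0%N) (A (graph_of h)) (size h).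

Lemma transcript_strategy_of (A : rel nat -> seq (nat * nat)) (g : rel nat)
    (n : nat) :
  nonanticipating A -> (n <= size (A g))%N ->
  transcript (strategy_of A) g n = [seq (q, answer g q) | q <- take n (A g)].
Proof.
move=> nA; elim: n => [|n IHn] len; first by rewrite take0.
have {}IHn := IHn (ltnW len).
rewrite (take_nth (0%N, 0%N)) // map_rcons /= IHn.
set h := map _ _.
suff -> : strategy_of A h = nth (0%N, 0%N) (A g) n by [].
have szh : size h = n by rewrite size_map size_takel // ltnW.
rewrite /strategy_of szh; apply/esym/nA => q qin.
rewrite {2}/answer /graph_of -surjective_pairing.
apply/idP/idP => [gq|/mapP[q' _ [-> /esym]]//].
by apply/mapP; exists q; rewrite ?gq.
Qed.

Definition state := nat -> seq nat.

(** The pivot is meant as a vertex of [H] whose image gets fixed, a target as a vertex adjacent to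
    it, and the quota as the number of candidates that this target must retain. *)
Record round := Round { pivot : nat; targets : seq nat; quota : nat -> nat }.

Implicit Types (x : round) (F : state) (g : rel nat) (l : seq round).

Definition queries x F : seq (nat * nat) :=
  [seq (c, f) | c <- F (pivot x), f <- flatten [seq F w | w <- targets x]].

Definition suitable x F g (c : nat) : bool :=
  all (fun w => quota x w <= count (g c) (F w))%N (targets x).

Definition succeeds x F g : bool := has (suitable x F g) (F (pivot x)).

Definition chosen x F g : nat := head 0%N [seq c <- F (pivot x) | suitable x F g c].

(* The failure branch keeps the update dependent on the queried pairs only. *)
Definition update x F g : state := fun w =>
  if ~~ succeeds x F g then [::]
  else if w == pivot x then [:: chosen x F g]
  else if w \in targets x then take (quota x w) [seq f <- F w | g (chosen x F g) f]
  else F w.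

Fixpoint trace l F g : seq (nat * nat) :=
  if l is x :: l' then queries x F ++ trace l' (update x F g) g else [::].

Fixpoint all_succeed l F g : bool :=
  if l is x :: l' then succeeds x F g && all_succeed l' (update x F g) g
  else true.

Fixpoint final l F g : state :=
  if l is x :: l' then final l' (update x F g) g else F.

Lemma suitable_agree x F g g' (c : nat) : agree (queries x F) g g' ->
  c \in F (pivot x) -> suitable x F g c = suitable x F g' c.
Proof.
move=> ag cin; apply: eq_in_all => w win; congr (_ <= _)%N.
apply: eq_in_count => f fin; apply: (ag (c, f)).
by apply: allpairs_f => //; apply/flattenP; exists (F w) => //; apply: map_f.
Qed.

Lemma succeeds_agree x F g g' : agree (queries x F) g g' ->
  succeeds x F g = succeeds x F g'.
Proof. by move=> ag; apply: eq_in_has => c; apply: suitable_agree. Qed.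

Lemma chosen_agree x F g g' : agree (queries x F) g g' ->
  chosen x F g = chosen x F g'.
Proof.
move=> ag; rewrite /chosen; congr head.
by apply: eq_in_filter => c; apply: suitable_agree.
Qed.

Lemma chosenP x F g : succeeds x F g ->
  chosen x F g \in F (pivot x) /\ suitable x F g (chosen x F g).
Proof.
rewrite /succeeds has_filter /chosen.
case E: (seq.filter _ _) => [//|c s] _ /=.
have : c \in [seq c <- F (pivot x) | suitable x F g c] by rewrite E mem_head.
by rewrite mem_filter => /andP[].
Qed.

Lemma in_queries x F (c w f : nat) : c \in F (pivot x) -> w \in targets x ->
  f \in F w -> (c, f) \in queries x F.
Proof.
move=> cin win fin; apply: allpairs_f => //; apply/flattenP.
by exists (F w) => //; apply: map_f.
Qed.

Lemma update_agree x F g g' : agree (queries x F) g g' ->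
  update x F g = update x F g'.
Proof.
move=> ag; apply/funext => w; rewrite /update -(succeeds_agree ag).
case: ifPn => // /negbNE ok; rewrite -(chosen_agree ag).
case: ifP => // _; case: ifP => // win; congr take.
apply: eq_in_filter => f fin; apply: (ag (_, f)).
by apply: (@in_queries _ _ _ w) => //; case: (chosenP ok).
Qed.

(** Within a round the queries are fixed by the state, and the next state reads only pairs just
    queried. *)
Lemma trace_nonanticipating l F : nonanticipating (trace l F).
Proof.
elim: l F => [|x l IHl] F g g' n //=.
rewrite take_cat !nth_cat; case: ltnP => // le ag.
have agq : agree (queries x F) g g'.
  by apply: agree_sub ag => q qin; rewrite mem_cat qin.
rewrite -(update_agree agq); apply: IHl.
by apply: agree_sub ag => q qin; rewrite mem_cat qin orbT.
Qed.

Lemma update_sub x F g (w : nat) : {subset update x F g w <= F w}.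
Proof.
move=> f; rewrite /update; case: ifPn => // /negbNE ok.
case: eqP => [-> |_]; first by rewrite inE => /eqP ->; case: (chosenP ok).
by case: ifP => // _ /mem_take; rewrite mem_filter => /andP[].
Qed.

Lemma final_sub l F g (w : nat) : {subset final l F g w <= F w}.
Proof.
elim: l F => [|x l IHl] F //= f /IHl; exact: update_sub.
Qed.

Definition blocks x : seq (nat * nat) := [seq (pivot x, w) | w <- targets x].

Definition forward x : bool := all (fun w => pivot x < w)%N (targets x).

(** In the round with pivot [u] and target [w] the candidates of [u] shrink to one vertex and those
    of [w] to neighbours of it; later rounds only shrink both. [forward] rules out a target equal to
    its own pivot. *)
Lemma final_adjacent l F g (u w c f : nat) : all_succeed l F g ->
  all forward l ->
  (u, w) \in flatten [seq blocks x | x <- l] ->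
  c \in final l F g u -> f \in final l F g w ->
  answer g (c, f) /\ (c, f) \in trace l F g.
Proof.
elim: l F => [|x l IHl] F //= /andP[ok okl] /andP[irr irrl].
rewrite mem_cat => /orP[/mapP[v win [-> ->]]|uwin] cin fin; last first.
  have [] // := IHl _ okl irrl uwin cin fin.
  by move=> gcf tcf; rewrite mem_cat tcf orbT.
have nv : v != pivot x.
  by rewrite gtn_eqF //; apply: (allP irr).
have := final_sub cin; rewrite /update ok eqxx /= inE => /eqP ec.
have := final_sub fin; rewrite /update ok /= (negPf nv) win => /mem_take.
rewrite mem_filter -ec => /andP[gcf fF]; split => //.
rewrite mem_cat (@in_queries _ _ _ v) // ec.
by case: (chosenP ok).
Qed.

(** Truncation to the quota makes the candidate sizes after a success independent of the answers, so
    sizes and costs are computed without the graph. *)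
Definition update_profile x (z : nat -> nat) : nat -> nat := fun w =>
  if w == pivot x then 1%N else if w \in targets x then quota x w else z w.

Definition final_profile l (z : nat -> nat) : nat -> nat :=
  foldl (fun z x => update_profile x z) z l.

Definition cost x (z : nat -> nat) : nat :=
  (z (pivot x) * \sum_(w <- targets x) z w)%N.

Fixpoint total_cost l (z : nat -> nat) : nat :=
  if l is x :: l' then (cost x z + total_cost l' (update_profile x z))%N else 0%N.

Lemma size_update x F g (z : nat -> nat) : succeeds x F g ->
  (forall w, size (F w) = z w) ->
  forall w, size (update x F g w) = update_profile x z w.
Proof.
move=> ok sz w; rewrite /update /update_profile ok /=.
case: ifP => // _; case: ifP => // win; apply: size_takel.
by rewrite size_filter; case: (chosenP ok) => _ /allP/(_ w win).
Qed.

Lemma size_queries x F (z : nat -> nat) : (forall w, size (F w) = z w) ->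
  size (queries x F) = cost x z.
Proof.
move=> sz; rewrite /queries size_allpairs sz /cost size_flatten; congr muln.
rewrite /shape -map_comp sumnE big_map.
by apply: eq_bigr => w _; rewrite /= sz.
Qed.

Lemma size_trace l F g (z : nat -> nat) : all_succeed l F g ->
  (forall w, size (F w) = z w) -> size (trace l F g) = total_cost l z.
Proof.
elim: l F z => [|x l IHl] F z //= /andP[ok okl] sz.
rewrite size_cat (size_queries x sz); congr addn.
by apply: IHl => //; apply: size_update.
Qed.

Lemma size_final l F g (z : nat -> nat) : all_succeed l F g ->
  (forall w, size (F w) = z w) ->
  forall w, size (final l F g w) = final_profile l z w.
Proof.
elim: l F z => [|x l IHl] F z //= /andP[ok okl] sz.
by apply: IHl => //; apply: size_update.
Qed.

(** The pool of [w] lies in the [w]-th interval of length [S], so dividing by [S] recovers the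
    vertex of [H] for which a graph vertex is a candidate. Hence pools are disjoint, and queries
    from different blocks are different pairs. *)
Definition well_placed (S : nat) F : Prop :=
  forall w, uniq (F w) /\ {in F w, forall f, (f %/ S)%N = w}.

Lemma well_placed_update (S : nat) x F g :
  well_placed S F -> well_placed S (update x F g).
Proof.
move=> wp w; split=> [|f /update_sub]; last by apply: (wp w).2.
rewrite /update; case: ifP => // _; case: ifP => // _; case: ifP => _.
  by apply/take_uniq/filter_uniq; case: (wp w).
by case: (wp w).
Qed.

Lemma uniq_flatten_pools (S : nat) F (W : seq nat) : well_placed S F ->
  uniq W -> uniq (flatten [seq F w | w <- W]).
Proof.
move=> wp; elim: W => //= w W IHW /andP[wW uW].
rewrite cat_uniq IHW // (wp w).1 andbT /=; apply/hasPn => f.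
move=> /flattenP[_ /mapP[v vW ->]] /((wp v).2) fv.
by apply: contra wW => /((wp w).2); rewrite fv => <-.
Qed.

Lemma uniq_queries (S : nat) x F : well_placed S F -> uniq (targets x) ->
  uniq (queries x F).
Proof.
move=> wp uW; apply: allpairs_uniq; first by case: (wp (pivot x)).
  exact: uniq_flatten_pools wp _.
by move=> [a b] [a' b'] _ _ /= [-> ->].
Qed.

Lemma queries_blocks (S : nat) x F (q : nat * nat) : well_placed S F ->
  q \in queries x F -> ((q.1 %/ S)%N, (q.2 %/ S)%N) \in blocks x.
Proof.
move=> wp /allpairsP[[c f] /= [cin /flattenP[_ /mapP[w win ->]] fin ->]] /=.
by rewrite ((wp _).2 _ cin) ((wp _).2 _ fin); apply: map_f.
Qed.

Lemma queries_ltn (S : nat) x F (q : nat * nat) : well_placed S F ->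
  forward x -> q \in queries x F -> (q.1 < q.2)%N.
Proof.
move=> wp fw /(queries_blocks wp)/mapP[w win [e1 e2]].
rewrite ltnNge; apply/negP => /(leq_div2r S).
by rewrite e1 e2 leqNgt (allP fw).
Qed.

End QueryRounds.

(** * Resampling finitely many pairs *)

(** The reversed pair is left alone, since forward rounds on well-placed pools query only pairs with
    the smaller vertex first. *)
Definition set_edge (g : rel nat) (q : nat * nat) (b : bool) : rel nat :=
  fun u v => if (u, v) == q then b else g u v.

Lemma answer_set_edge (g : rel nat) (q q' : nat * nat) (b : bool) :
  answer (set_edge g q b) q' = if q' == q then b else answer g q'.
Proof. by rewrite /answer /set_edge -surjective_pairing. Qed.

Definition agree_off (D : seq (nat * nat)) (g g' : rel nat) : Prop :=
  forall q, q \notin D -> answer g' q = answer g q.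

Lemma agree_off_set_edge (D : seq (nat * nat)) (g g' : rel nat) q (b : bool) :
  agree_off D (set_edge g q b) g' -> agree_off (q :: D) g g'.
Proof.
move=> a q'; rewrite inE negb_or => /andP[/negPf ne /a ->].
by rewrite answer_set_edge ne.
Qed.

Section Expectation.
Context {R : realType}.
Variable p : R.
Hypothesis p01 : 0 <= p <= 1.
Implicit Types (D : seq (nat * nat)) (f : rel nat -> R) (g : rel nat).

(* Expectation of f when the pairs of D are resampled independently with edge
   probability p and all other pairs are as in g. *)
Fixpoint expect D f g : R :=
  if D is q :: D' then
    p * expect D' f (set_edge g q true)
    + (1 - p) * expect D' f (set_edge g q false)
  else f g.

Lemma expect_le D f f' g :
  (forall g', agree_off D g g' -> f g' <= f' g') ->
  expect D f g <= expect D f' g.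
Proof.
elim: D g => [|q D IHD] g /= le_ff'; first exact: le_ff'.
have /andP[p0 p1] := p01.
by apply: lerD; apply: ler_wpM2l; rewrite ?subr_ge0 //;
   apply: IHD => g' /agree_off_set_edge; apply: le_ff'.
Qed.

Lemma expect_eq D f f' g :
  (forall g', agree_off D g g' -> f g' = f' g') ->
  expect D f g = expect D f' g.
Proof.
by move=> eq_ff'; apply/eqP; rewrite eq_le !expect_le // => g' /eq_ff' ->.
Qed.

Lemma expect_cat D D' f g :
  expect (D ++ D') f g = expect D (expect D' f) g.
Proof. by elim: D g => [|q D IHD] g //=; rewrite !IHD. Qed.

Lemma expectZ D (c : R) f g :
  expect D (fun g => c * f g) g = c * expect D f g.
Proof. by elim: D g => [|q D IHD] g //=; rewrite !IHD; ring. Qed.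

Lemma expect_compl D f g :
  expect D (fun g => 1 - f g) g = 1 - expect D f g.
Proof. by elim: D g => [|q D IHD] g //=; rewrite !IHD; ring. Qed.

(** The probability that a binomial variable with [s] trials of probability [p] is at least [t], by
    conditioning on the first trial. *)
Fixpoint binomial_tail (s t : nat) : R :=
  match s, t with
  | _, 0 => 1
  | 0, _.+1 => 0
  | s'.+1, t'.+1 => p * binomial_tail s' t' + (1 - p) * binomial_tail s' t
  end.

Lemma binomial_tail0 (s : nat) : binomial_tail s 0 = 1.
Proof. by case: s. Qed.

Lemma expect_cst D (c : R) g : expect D (fun=> c) g = c.
Proof. by elim: D g => [|q D IHD] g //=; rewrite !IHD; ring. Qed.

Lemma expect_count (c t : nat) (L : seq nat) g : uniq L ->
  expect [seq (c, v) | v <- L] (fun g => (t <= count (g c) L)%N%:R) g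
  = binomial_tail (size L) t.
Proof.
elim: L t g => [|v L IHL] [|t] g // uL; first by rewrite expect_cst.
move: uL => /= /andP[vL uL].
have vD : (c, v) \notin [seq (c, v) | v <- L].
  by apply: contra vL => /mapP[v' v'in [->]].
congr (_ * _ + _ * _).
  rewrite -(IHL _ (set_edge g (c, v) true)) //; apply: expect_eq => g' ag.
  by have := ag _ vD; rewrite answer_set_edge eqxx /answer /= => ->.
rewrite -(IHL _ (set_edge g (c, v) false)) //; apply: expect_eq => g' ag.
by have := ag _ vD; rewrite answer_set_edge eqxx /answer /= => ->.
Qed.

Lemma agree_off_count D g g' (c : nat) (L : seq nat) : agree_off D g g' ->
  {in L, forall v, (c, v) \notin D} -> count (g' c) L = count (g c) L.
Proof. by move=> ag LD; apply: eq_in_count => v /LD/ag. Qed.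

(** The pools of distinct targets are disjoint, so their counts of neighbours of [c] are
    independent. *)
Lemma expect_suitable x (F : state) (c : nat) g :
  uniq (flatten [seq F w | w <- targets x]) ->
  expect [seq (c, v) | v <- flatten [seq F w | w <- targets x]]
    (fun g => (suitable x F g c)%:R) g
  = \prod_(w <- targets x) binomial_tail (size (F w)) (quota x w).
Proof.
rewrite /suitable; elim: (targets x) g => [|w W IHW] g /=.
  by rewrite big_nil.
rewrite cat_uniq => /and3P[uw disj uW].
rewrite map_cat expect_cat big_cons.
rewrite -(expect_count c (quota x w) g uw) mulrC -expectZ.
apply: expect_eq => g1 _; rewrite -(IHW g1) // mulrC -expectZ.
apply: expect_eq => g2 ag; rewrite -mulnb natrM; congr (_%:R * _).
congr (_ <= _)%N; apply: agree_off_count ag _ => v vw.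
apply: contra disj => /mapP[v' v'in [ev]].
by apply/hasP; exists v' => //; rewrite -ev.
Qed.

(** Distinct candidates of the pivot use disjoint sets of pairs, so they fail independently. *)
Lemma expect_failure x (F : state) g :
  uniq (F (pivot x)) -> uniq (flatten [seq F w | w <- targets x]) ->
  expect (queries x F) (fun g => (~~ succeeds x F g)%:R) g
  = (1 - \prod_(w <- targets x) binomial_tail (size (F w)) (quota x w))
      ^+ size (F (pivot x)).
Proof.
move=> uF uL; rewrite /queries /succeeds.
elim: (F (pivot x)) g uF => [|c s IHs] g /=; first by rewrite expr0.
move=> /andP[cs us]; rewrite expect_cat exprS.
rewrite -{1}(expect_suitable c g uL) -expect_compl mulrC -expectZ.
apply: expect_eq => g1 _; rewrite -(IHs g1) // mulrC -expectZ.
apply: expect_eq => g2 ag; rewrite negb_or -mulnb natrM; congr (_ * _).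
suff -> : suitable x F g2 c = suitable x F g1 c by case: suitable; rewrite ?subrr ?subr0.
apply: eq_in_all => w win; congr (_ <= _)%N; apply: agree_off_count ag _ => v vw.
by apply: contra cs => /allpairsP[[c' v'] /= [c'in _ [->]]].
Qed.

Lemma binomial_tail_ge0 (s t : nat) : 0 <= binomial_tail s t.
Proof.
have /andP[p0 p1] := p01.
elim: s t => [|s IHs] [|t] //=.
by rewrite addr_ge0 // mulr_ge0 // subr_ge0.
Qed.

Lemma binomial_tail_le1 (s t : nat) : binomial_tail s t <= 1.
Proof.
have /andP[p0 p1] := p01.
elim: s t => [|s IHs] [|t] //=.
apply: le_trans (_ : p * 1 + (1 - p) * 1 <= 1); last by lra.
by rewrite lerD // ler_wpM2l // subr_ge0.
Qed.

Lemma binomial_tailSr (s t : nat) : binomial_tail s t.+1 <= binomial_tail s t.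
Proof.
have /andP[p0 p1] := p01.
elim: s t => [|s IHs] [|t] //=; last first.
  by rewrite lerD // ler_wpM2l // subr_ge0.
exact: (binomial_tail_le1 s.+1 1).
Qed.

Lemma binomial_tailSl (s t : nat) : binomial_tail s t <= binomial_tail s.+1 t.
Proof.
have /andP[p0 p1] := p01.
case: t => [|t]; first by rewrite !binomial_tail0.
rewrite [leRHS]/=; have := ler_wpM2l p0 (binomial_tailSr s t); lra.
Qed.

(** One success among the first [r] trials and [t] among the other [s] suffice. *)
Lemma binomial_tail_add (r s t : nat) :
  (1 - (1 - p) ^+ r) * binomial_tail s t <= binomial_tail (r + s) t.+1.
Proof.
have /andP[p0 p1] := p01.
have q0 : 0 <= 1 - p by rewrite subr_ge0.
elim: r => [|r IHr].
  by rewrite expr0 subrr mul0r; apply: binomial_tail_ge0.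
have mono : binomial_tail s t <= binomial_tail (r + s) t.
  elim: r {IHr} => // r IHr; rewrite addSn.
  exact: le_trans IHr (binomial_tailSl _ _).
rewrite addSn [leRHS]/= exprS.
have := ler_wpM2l q0 IHr; have := ler_wpM2l p0 mono; lra.
Qed.

(** Cut the trials into [t] blocks of length [r] and ask for a success in each. *)
Lemma binomial_tail_ge (r s t : nat) : (t * r <= s)%N ->
  (1 - (1 - p) ^+ r) ^+ t <= binomial_tail s t.
Proof.
have /andP[p0 p1] := p01.
elim: t s => [|t IHt] s le; first by rewrite expr0 binomial_tail0.
rewrite mulSn in le.
have -> : s = (r + (s - r))%N by rewrite subnKC // (leq_trans (leq_addr _ _) le).
rewrite exprS; apply: le_trans (binomial_tail_add _ _ _).
apply: ler_wpM2l; last by apply: IHt; rewrite leq_subRL // (leq_trans (leq_addr _ _) le).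
by rewrite subr_ge0 exprn_ile1 ?subr_ge0 // gerBl.
Qed.

(* Markov's inequality for 2^-X with X binomial. *)
Lemma binomial_tail_deviation (s t : nat) :
  1 - binomial_tail s t <= 2 ^+ t * (1 - p / 2) ^+ s.
Proof.
have /andP[p0 p1] := p01.
have h0 : 0 <= 1 - p / 2 by lra.
elim: s t => [|s IHs] [|t]; rewrite ?binomial_tail0 ?subrr.
- by rewrite mulr_ge0 ?exprn_ge0.
- by rewrite /= subr0 expr0 mulr1 exprn_ege1 // ler1n.
- by rewrite mulr_ge0 ?exprn_ge0.
rewrite /=.
have q0 : 0 <= 1 - p by rewrite subr_ge0.
have := ler_wpM2l q0 (IHs t.+1); have := ler_wpM2l p0 (IHs t).
rewrite !exprS; move: (2 ^+ t) ((1 - p / 2) ^+ s) => a b.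
move: (binomial_tail s t) (binomial_tail s t.+1) => u v; lra.
Qed.

End Expectation.

(** * Success probability in the random graph *)

Section Measure.
Context {R : realType} {disp : measure_display} {T : measurableType disp}.
Variables (P : probability T R) (G : T -> rel nat) (p : R).
Hypothesis GER : erdos_renyi P G p.
Hypothesis p01 : 0 <= p <= 1.

Let measurable_edge (q : nat * nat) : measurable [set w | answer (G w) q].
Proof. by case: GER => _ + _ _; apply. Qed.

Lemma measurable_answer (q : nat * nat) (b : bool) :
  measurable [set w | answer (G w) q = b].
Proof.
case: b; first exact: measurable_edge.
rewrite (_ : [set _ | _] = ~` [set w | answer (G w) q]).
  exact/measurableC/measurable_edge.
by apply/seteqP; split => w /= => [->|/negP/negbTE].
Qed.

(** A transcript takes countably many values, and each is attained on a finite intersection of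
    events about single answers. *)
Lemma measurable_transcript (s : strategy) (n : nat) (Q : history -> Prop) :
  measurable [set w | Q (transcript s (G w) n)].
Proof.
have m1 (h : history) : measurable [set w | transcript s (G w) n = h].
  elim: n h => [|n IHn] h /=.
    have [->|/eqP ne] := eqVneq h [::].
      by rewrite (_ : [set _ | _] = setT) //; apply/seteqP; split.
    rewrite (_ : [set _ | _] = set0) //; apply/seteqP; split => // w /= e.
    by apply: ne.
  case/lastP: h => [|h [q b]].
    rewrite (_ : [set _ | _] = set0) //; apply/seteqP; split => // w /=.
    by move/(congr1 size); rewrite size_rcons.
  have [eq|ne] := pselect (q = s h); last first.
    rewrite (_ : [set _ | _] = set0) //; apply/seteqP; split => // w /=.
    by move/rcons_inj => [e1 e2 _]; apply: ne; rewrite -e2 e1.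
  rewrite (_ : [set _ | _] = [set w | transcript s (G w) n = h]
                              `&` [set w | answer (G w) q = b]).
    exact: measurableI (IHn h) (measurable_answer q b).
  apply/seteqP; split => w /=.
    by move/rcons_inj => [e1 e2 e3]; rewrite -e3 eq -e1.
  by move=> [-> <-]; rewrite eq.
rewrite (_ : [set _ | _] =
    \bigcup_h ([set w | transcript s (G w) n = h] `&` [set _ | Q h])).
  apply: countable_bigcupT_measurable => [|h]; first exact: countableP.
  apply: measurableI => //.
  have [Qh|nQh] := pselect (Q h).
    by rewrite (_ : [set _ | _] = setT) //; apply/seteqP; split.
  by rewrite (_ : [set _ | _] = set0) //; apply/seteqP; split.
apply/seteqP; split => w /=; first by exists (transcript s (G w) n).
by move=> [h _ [/= ->]].
Qed.

Definition prob (A : set T) : R := fine (P A).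

Lemma prob_ge0 (A : set T) : 0 <= prob A.
Proof. exact: fine_ge0. Qed.

Lemma prob_split (A B : set T) : measurable A -> measurable B ->
  prob A = prob (A `&` B) + prob (A `&` ~` B).
Proof.
move=> mA mB; rewrite /prob -fineD; last 2 first.
- by apply: fin_num_measure; apply: measurableI.
- by apply: fin_num_measure; apply: measurableI => //; apply: measurableC.
by rewrite -setDE addeC -measureDI.
Qed.

Definition consistent (h : history) : set T :=
  [set w | {in h, forall qb, answer (G w) qb.1 = qb.2}].

Definition weight (h : history) : R := \prod_(qb <- h) (if qb.2 then p else 1 - p).

Lemma consistent_cons (q : nat * nat) (b : bool) (h : history) :
  consistent ((q, b) :: h) = consistent h `&` [set w | answer (G w) q = b].
Proof.
apply/seteqP; split => w /= => [c|[c e] qb].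
  split=> [qb qbh|]; last exact: (c _ (mem_head _ _)).
  by apply: c; rewrite inE qbh orbT.
by rewrite inE => /orP[/eqP -> //|/c].
Qed.

Lemma consistent_rcons (q : nat * nat) (b : bool) (h : history) :
  consistent (rcons h (q, b)) = consistent h `&` [set w | answer (G w) q = b].
Proof.
rewrite -consistent_cons; apply/seteqP; split => w /= c qb.
  by move=> qbh; apply: c; rewrite mem_rcons.
by move=> qbh; apply: c; rewrite -mem_rcons.
Qed.

Lemma measurable_consistent (h : history) : measurable (consistent h).
Proof.
elim: h => [|[q b] h IHh].
  by rewrite (_ : consistent _ = setT) //; apply/seteqP; split.
by rewrite consistent_cons; apply: measurableI => //; apply: measurable_answer.
Qed.

(** [erdos_renyi] states the product rule for present edges only. A negative answer is handled by
    subtraction: the event without the pair, minus the event where the pair is an edge. *)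
Lemma prob_consistent (h : history) : uniq (unzip1 h) ->
  all (fun q => q.1 < q.2)%N (unzip1 h) -> prob (consistent h) = weight h.
Proof.
pose pos (s : seq (nat * nat)) := [seq (q, true) | q <- s].
(* The extra positive pairs [s] receive the pair being subtracted, which keeps the induction on [h]
   going. *)
suff gen s : uniq (unzip1 h ++ s) -> all (fun q => q.1 < q.2)%N (unzip1 h ++ s) ->
    prob (consistent (h ++ pos s)) = weight h * p ^+ size s.
  by move=> u a; have := gen [::]; rewrite /pos !cats0 expr0 mulr1; apply.
elim: h s => [|[q b] h IHh] s /=.
  move=> us /= alls; rewrite /weight big_nil mul1r.
  have -> : consistent (pos s) =
      [set w | forall uv, uv \in s -> edge_event G uv.1 uv.2 w].
    apply/seteqP; split => w /= c qb.
      by move=> qs; apply: (c (qb, true)); apply: map_f.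
    by move=> /mapP[q qs ->]; apply: c.
  rewrite /prob; case: GER => _ _ Pe -> //.
  have -> : (\prod_(uv <- s) P (edge_event G uv.1 uv.2) = (p ^+ size s)%:E)%E.
    elim: s {us} alls => [|q s IHs] /=; first by rewrite big_nil expr0.
    move=> /andP[lt alls]; rewrite big_cons (IHs alls) Pe ?exprS ?EFinM //.
    by rewrite ltn_eqF.
  by [].
move=> /andP[]; rewrite mem_cat negb_or => /andP[qh qs] uhs /andP[lt alls].
have IHt : prob (consistent ((q, true) :: h ++ pos s)) = weight h * p ^+ (size s).+1.
  have := IHh (q :: s); rewrite /= cat_uniq /= negb_or qh /= qs /=.
  move: uhs; rewrite cat_uniq => /and3P[-> -> ->].
  move: alls; rewrite !all_cat /= lt /= => -> => <- //.
  congr prob; apply/seteqP; split => w /= c qb;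
    rewrite ?inE mem_cat ?inE => qbin; apply: c;
    by rewrite ?inE mem_cat ?inE; case/or3P: qbin => ->; rewrite ?orbT.
rewrite /weight big_cons /= -/(weight h); case: b.
  by rewrite IHt exprS; ring.
have := IHh s uhs alls.
rewrite (@prob_split _ [set w | answer (G w) q = true]) //; last 2 first.
- exact: measurable_consistent.
- exact: measurable_answer.
rewrite -consistent_cons IHt consistent_cons.
rewrite (_ : ~` _ = [set w | answer (G w) q = false]); last first.
  by apply/seteqP; split => w /= => [/negP/negbTE|->].
by rewrite exprS => e; lra.
Qed.

Lemma weight_ge0 (h : history) : 0 <= weight h.
Proof.
have /andP[p0 p1] := p01.
by apply: prodr_ge0 => -[q []] _ //=; rewrite subr_ge0.
Qed.

Definition answers (g : rel nat) (D : seq (nat * nat)) : history :=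
  [seq (q, answer g q) | q <- D].

(** Law of total probability over the answer patterns on [D]: bounds under all extended histories
    average to a bound under [h]. *)
Lemma expect_le_prob (D : seq (nat * nat)) (h : history) (f : rel nat -> R)
    (g : rel nat) (Y : set T) : measurable Y -> uniq D ->
  (forall g', agree_off D g g' ->
    weight (h ++ answers g' D) * f g' <= prob (consistent (h ++ answers g' D) `&` Y)) ->
  weight h * expect p D f g <= prob (consistent h `&` Y).
Proof.
move=> mY; elim: D h g => [|q D IHD] h g /=.
  by move=> _ /(_ g); rewrite cats0; apply.
move=> /andP[qD uD] le.
have IH b : weight (rcons h (q, b)) * expect p D f (set_edge g q b) <=
    prob (consistent (rcons h (q, b)) `&` Y).
  apply: IHD => // g' ag; rewrite cat_rcons.
  have -> : b = answer g' q by rewrite ag // answer_set_edge eqxx.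
  exact: le (agree_off_set_edge ag).
have wr b : weight (rcons h (q, b)) = weight h * (if b then p else 1 - p).
  by rewrite /weight -cats1 big_cat big_seq1.
have mh := measurable_consistent h.
rewrite (@prob_split _ [set w | answer (G w) q = true]); last 2 first.
- exact: measurableI.
- exact: measurable_answer.
rewrite (_ : ~` _ = [set w | answer (G w) q = false]); last first.
  by apply/seteqP; split => w /= => [/negP/negbTE|->].
have := IH true; have := IH false; rewrite !wr !consistent_rcons /=.
rewrite !(setIAC _ Y) => h1 h2.
by rewrite mulrDr !mulrA; apply: lerD.
Qed.

Definition failure_bound (x : round) (z : nat -> nat) : R :=
  (1 - \prod_(w <- targets x) binomial_tail p (z w) (quota x w)) ^+ z (pivot x).

Fixpoint low_risk (eps : R) (l : seq round) (z : nat -> nat) : Prop :=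
  if l is x :: l' then
    failure_bound x z <= eps /\ low_risk eps l' (update_profile x z)
  else True.

(** Induction over the rounds, conditioned on the history [h] of the earlier ones. No earlier query
    lies in a block still to come, so the pairs of the next round are fresh and its failure
    probability is exactly [failure_bound]. *)
Lemma prob_all_succeed (S : nat) (eps : R) (l : seq round) (F : state)
    (z : nat -> nat) (h : history) (Y : set T) :
  measurable Y -> eps <= 1 -> well_placed S F -> (forall w, size (F w) = z w) ->
  all forward l -> uniq (flatten [seq blocks x | x <- l]) -> low_risk eps l z ->
  uniq (unzip1 h) -> all (fun q => q.1 < q.2)%N (unzip1 h) ->
  (forall q, q \in unzip1 h ->
    ((q.1 %/ S)%N, (q.2 %/ S)%N) \notin flatten [seq blocks x | x <- l]) ->
  (forall w, consistent h w -> all_succeed l F (G w) -> Y w) ->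
  weight h * (1 - eps) ^+ size l <= prob (consistent h `&` Y).
Proof.
move=> mY eps1; elim: l F z h => [|x l IHl] F z h wp sz /=.
  move=> _ _ _ uh lth _ sub; rewrite expr0 mulr1 -prob_consistent //.
  rewrite (_ : _ `&` _ = consistent h) //.
  by apply/seteqP; split => w; [case | move=> cw; split => //; apply: sub].
move=> /andP[fwx fwl]; rewrite cat_uniq => /and3P[ux disj ul] [risk riskl].
move=> uh lth hb sub.
have ut : uniq (targets x) by apply: map_uniq ux.
have uq := uniq_queries wp ut.
have e0 : 0 <= 1 - eps by rewrite subr_ge0.
(* The success indicator of this round times the bound for the later ones. The base graph of the
   expectation is arbitrary, as every pair of the round is resampled. *)
pose f g : R := (1 - eps) ^+ size l * (succeeds x F g)%:R.
suff: weight h * expect p (queries x F) f (fun _ _ => false) <=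
    prob (consistent h `&` Y).
  apply: le_trans; apply: ler_wpM2l; first exact: weight_ge0.
  rewrite expectZ exprSr; apply: ler_wpM2l; first exact: exprn_ge0.
  rewrite (_ : expect _ _ _ _ =
      expect p (queries x F) (fun g => 1 - (~~ succeeds x F g)%:R) (fun _ _ => false)).
    rewrite expect_compl (@expect_failure _ _ p01) ?(wp _).1 //; last first.
      exact: uniq_flatten_pools wp ut.
    rewrite lerD2l lerN2; apply: le_trans risk.
    by rewrite /failure_bound sz; under eq_bigr do rewrite sz.
  by apply: (@expect_eq _ _ p01) => g _; case: succeeds; rewrite ?subr0 ?subrr.
apply: expect_le_prob => // g _; rewrite /f.
case ok: (succeeds x F g); last by rewrite !mulr0 prob_ge0.
rewrite mulr1.
have eh : unzip1 (h ++ answers g (queries x F)) = unzip1 h ++ queries x F.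
  by rewrite /unzip1 map_cat -map_comp (@eq_map _ _ _ id) ?map_id.
apply: (IHl (update x F g) (update_profile x z)) => //.
- exact: well_placed_update.
- exact: size_update.
- rewrite eh cat_uniq uh uq andbT /=; apply/hasPn => q qx; apply/negP => /hb.
  by rewrite mem_cat (queries_blocks wp qx).
- rewrite eh all_cat lth; apply/allP => q; exact: queries_ltn wp fwx.
- move=> q; rewrite eh mem_cat => /orP[/hb|/(queries_blocks wp) qx].
    by rewrite mem_cat negb_or => /andP[].
  by apply: contra disj => qin; apply/hasP; exists ((q.1 %/ S)%N, (q.2 %/ S)%N).
move=> w cw okl; apply: sub => [qb qbh|].
  by apply: cw; rewrite mem_cat qbh.
have ag : agree (queries x F) (G w) g.
  by move=> q qx; apply: (cw (q, _)); rewrite mem_cat map_f ?orbT.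
by rewrite (succeeds_agree ag) ok (update_agree ag).
Qed.
End Measure.

(** * Levels of an acyclic orientation *)

Lemma acyclic_path_uniq (V : finType) (O : rel V) (x : V) (s : seq V) :
  acyclic O -> path O x s -> uniq (x :: s).
Proof.
move=> ac; elim: s x => // y s IHs x pxs.
have [_ pys] := andP pxs; rewrite cons_uniq IHs // andbT.
apply/negP => /splitPr xs; case: xs pxs => s1 s2.
rewrite -cat_rcons cat_path => /andP[cyc _].
by have := ac (x :: s1) cyc.
Qed.

(** The level of [x] is the length of a longest directed path from [x]. Acyclicity makes every path
    free of repetitions, so the bound [l] applies to it. *)
Lemma acyclic_levels (V : finType) (O : rel V) (l : nat) :
  acyclic O -> directed_paths_le O l ->
  exists lev : V -> nat, (forall x, lev x <= l)%N /\
    (forall x y, O x y -> lev y < lev x)%N.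
Proof.
move=> ac short.
pose has_path x := [pred i : 'I_l.+1 | [exists t : i.-tuple V, path O x t]].
exists (fun x => \max_(i | has_path x i) i)%N; split=> [x|x y Oxy].
  by apply/bigmax_leqP => i _; rewrite -ltnS.
have h0 : has_path y ord0 by apply/existsP; exists [tuple].
have /(eq_bigmax_cond (@nat_of_ord l.+1))[j hj ->] : (0 < #|has_path y|)%N.
  by apply/card_gt0P; exists ord0.
have /existsP[t pt] := hj.
have pyt : path O x (y :: t) by rewrite /= Oxy.
have := short _ _ pyt (acyclic_path_uniq ac pyt); rewrite /= size_tuple => jl.
have jl' : (j.+1 < l.+1)%N by [].
by apply: (@leq_bigmax_cond _ _ _ (Ordinal jl')); apply/existsP; exists [tuple of y :: t].
Qed.

(** Numbering the vertices by nondecreasing level moves the orientation to the numbers below [#|V|],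
    with every arc towards a smaller number. *)
Lemma topological_order (V : finType) (e O : rel V) (d l : nat) :
  orientation e O -> acyclic O -> max_outdegree_le O d ->
  directed_paths_le O l ->
  exists (idx : V -> nat) (o : rel nat) (lev : nat -> nat),
    [/\ injective idx, forall x, (idx x < #|V|)%N,
        forall x y, e x y -> o (idx x) (idx y) || o (idx y) (idx x),
        forall w u, o w u -> [&& u < w, w < #|V| & lev u < lev w]%N
      & (forall w, lev w <= l)%N /\ (forall w, count (o w) (iota 0 #|V|) <= d)%N].
Proof.
(* The empty graph is split off because [nth] needs a default vertex. *)
move=> [_ eO] ac dO short; case: (pickP V) => [x0 _|V0]; last first.
  exists (fun=> 0%N), (fun _ _ => false), (fun=> 0%N).
  split=> [x|x|x y|//|]; try by have := V0 x.
  by split=> // w; rewrite count_pred0.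
have [lev [lev_le levO]] := acyclic_levels ac short.
pose r := relpre lev leq.
pose s := sort r (enum V).
have us : uniq s by rewrite sort_uniq enum_uniq.
have ss : size s = #|V| by rewrite size_sort cardE.
have ins x : x \in s by rewrite mem_sort mem_enum.
have sorts : sorted r s by apply: sort_sorted => x y; apply: leq_total.
have rr : reflexive r by move=> x; rewrite /r /=.
have rt : transitive r by move=> y x z; apply: leq_trans.
pose o w u := [&& w < #|V|, u < #|V| & O (nth x0 s w) (nth x0 s u)]%N.
exists (index^~ s), o, (lev \o nth x0 s); split.
- by move=> x y /(congr1 (nth x0 s)); rewrite !nth_index.
- by move=> x; rewrite -ss index_mem.
- move=> x y exy; rewrite /o !nth_index // -ss !index_mem !ins /=.
  by have := eO _ _ exy; case: (O x y).
- move=> w u /and3P[wV uV Owu]; rewrite wV /= levO // andbT ltnNge.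
  apply/negP => wu; have := levO _ _ Owu; rewrite ltnNge => /negP; apply.
  by apply: (sorted_leq_nth rt rr x0 sorts); rewrite ?inE ?ss.
split=> [w|w]; first exact: lev_le.
have [wV|wV] := ltnP w #|V|; last first.
  by rewrite (@eq_count _ _ pred0) ?count_pred0 // => u; rewrite /o ltnNge wV.
apply: leq_trans (dO (nth x0 s w)).
rewrite -size_filter -(size_map (nth x0 s)) cardE; apply: uniq_leq_size.
  rewrite map_inj_in_uniq ?filter_uniq ?iota_uniq // => u v.
  rewrite !mem_filter => /andP[/and3P[_ uV _] _] /andP[/and3P[_ vV _] _] /eqP.
  by rewrite nth_uniq ?ss // => /eqP.
move=> _ /mapP[u + ->]; rewrite mem_filter => /andP[/and3P[_ _ Owu] _].
by rewrite mem_enum inE.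
Qed.

(** * Rounds placing the vertices one by one *)

Section Rounds.
Variables (n : nat) (o : rel nat) (lev M : nat -> nat) (a b : nat).
Hypothesis o_lt : forall w u, o w u -> (u < w < n)%N.

(** Vertices are placed in increasing order, so these are the out-neighbours of [w] not yet placed
    when the turn of [u] comes. *)
Definition remaining (w u : nat) : nat := count (o w) (iota u (n - u)).

(* Size of the candidate set of a vertex with k out-neighbours to be placed. *)
Definition pool_size (w k : nat) : nat :=
  if k is k'.+1 then (b * a ^ k')%N else M (lev w).

(* The vertices whose last out-neighbour is u force the choice of the image of
   u, so they come first; the others are then filtered for that image only. *)
Definition placing_round (last : bool) (u : nat) : round :=
  Round u [seq w <- iota 0 n | o w u && ((remaining w u.+1 == 0%N) == last)]
    (fun w => pool_size w (remaining w u.+1)).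

Definition placing_rounds (s : seq nat) : seq round :=
  flatten [seq [:: placing_round true u; placing_round false u] | u <- s].

(** The predicted candidate sizes at the turn of [u]; a vertex already placed has a single
    candidate. *)
Definition profile (u w : nat) : nat :=
  if (w < u)%N then 1%N else pool_size w (remaining w u).

Lemma remainingS (w u : nat) : (u < n)%N ->
  remaining w u = (o w u + remaining w u.+1)%N.
Proof. by move=> un; rewrite /remaining -(subnSK un). Qed.

Lemma remaining_eq0 (w u : nat) : (w <= u)%N -> remaining w u = 0%N.
Proof.
move=> wu; rewrite /remaining (@eq_in_count _ _ pred0) ?count_pred0 // => v.
rewrite mem_iota => /andP[uv _]; apply/negP => /o_lt /andP[vw _].
by have := leq_trans (leq_trans vw wu) uv; rewrite ltnn.
Qed.

Lemma mem_targets (last : bool) (u w : nat) :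
  (w \in targets (placing_round last u)) =
  o w u && ((remaining w u.+1 == 0%N) == last).
Proof.
rewrite mem_filter mem_iota /=; case owu: (o w u) => //=.
by have /andP[_ ->] := o_lt owu; rewrite andbT.
Qed.

Lemma update_profile_placing (u : nat) : (u < n)%N ->
  update_profile (placing_round false u)
    (update_profile (placing_round true u) (profile u)) = profile u.+1.
Proof.
move=> un; apply/funext => w; rewrite /update_profile !mem_targets /=.
rewrite /profile ltnS; case: (ltngtP w u) => [wu|uw|//]; last first.
  rewrite (remainingS w un); case: (o w u) => //=.
  by case: (remaining w u.+1 == 0%N).
have -> : o w u = false by apply/negP => /o_lt; lia.
by [].
Qed.

Lemma placing_forward (s : seq nat) : all forward (placing_rounds s).
Proof.
rewrite /placing_rounds; elim: s => //= u s ->.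
by rewrite andbT; apply/andP; split; apply/allP => w;
  rewrite mem_targets => /andP[/o_lt /andP[]].
Qed.

Lemma mem_placing_blocks (s : seq nat) (u w : nat) :
  ((u, w) \in flatten [seq blocks x | x <- placing_rounds s]) =
  (u \in s) && o w u.
Proof.
have mem_blocks last v :
    ((u, w) \in blocks (placing_round last v)) =
    (u == v) && (o w v && ((remaining w v.+1 == 0%N) == last)).
  rewrite -mem_targets; apply/mapP/idP => [[w' w'in [-> ->]]|/andP[/eqP -> win]].
    by rewrite eqxx.
  by exists w.
rewrite /placing_rounds; elim: s => //= v s IHs.
rewrite !mem_cat !mem_blocks IHs inE; case: (eqVneq u v) => [->|_] //=.
by case: (o w v); case: (remaining w v.+1 == 0%N); rewrite //= andbF.
Qed.

(** The test on the last out-neighbour sends each arc into exactly one of the two rounds of its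
    head. *)
Lemma uniq_placing_blocks (s : seq nat) : uniq s ->
  uniq (flatten [seq blocks x | x <- placing_rounds s]).
Proof.
have uniq_blocks last u : uniq (blocks (placing_round last u)).
  by rewrite map_inj_uniq ?filter_uniq ?iota_uniq // => w w' [].
elim: s => //= u s IHs /andP[us uniq_s].
rewrite catA !cat_uniq !uniq_blocks /= andbT; apply/and3P; split.
- apply/hasPn => _ /mapP[w + ->]; rewrite mem_targets => /andP[_ /eqP rw].
  apply/negP => /mapP[w' + [e]]; rewrite -e mem_targets rw.
  by rewrite andbF.
- apply/hasPn => -[v w]; rewrite mem_placing_blocks => /andP[vs _].
  apply: contra us => vin; suff <- : v = u by [].
  by move: vin; rewrite mem_cat => /orP[] /mapP[w' _ [-> _]].
- exact: IHs.
Qed.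

Lemma final_profile_placing :
  final_profile (placing_rounds (iota 0 n)) (profile 0) = profile n.
Proof.
suff gen k u : (u + k = n)%N ->
    final_profile (placing_rounds (iota u k)) (profile u) = profile n by exact: gen.
elim: k u => [|k IHk] u ukn /=; first by rewrite -ukn addn0.
rewrite /final_profile /= update_profile_placing; last by lia.
by apply: IHk; lia.
Qed.

Lemma total_cost_placing (B : nat) :
  (forall u, (u < n)%N -> cost (placing_round true u) (profile u) +
     cost (placing_round false u)
       (update_profile (placing_round true u) (profile u)) <= B)%N ->
  (total_cost (placing_rounds (iota 0 n)) (profile 0) <= n * B)%N.
Proof.
move=> costB; suff gen k u : (u + k = n)%N ->
  (total_cost (placing_rounds (iota u k)) (profile u) <= k * B)%N by exact: gen.
elim: k u => [|k IHk] u ukn //=; rewrite addnA mulSn.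
have un : (u < n)%N by lia.
rewrite leq_add ?costB // update_profile_placing //; apply: IHk; lia.
Qed.

Lemma low_risk_placing (R : realType) (p eps : R) :
  (forall u, (u < n)%N ->
     failure_bound p (placing_round true u) (profile u) <= eps /\
     failure_bound p (placing_round false u)
       (update_profile (placing_round true u) (profile u)) <= eps) ->
  low_risk p eps (placing_rounds (iota 0 n)) (profile 0).
Proof.
move=> risk; suff gen k u : (u + k = n)%N ->
  low_risk p eps (placing_rounds (iota u k)) (profile u) by exact: gen.
elim: k u => [|k IHk] u ukn //=.
have un : (u < n)%N by lia.
have [r1 r2] := risk u un; split=> //; split=> //.
by rewrite update_profile_placing //; apply: IHk; lia.
Qed.

Lemma size_placing_rounds (s : seq nat) :
  size (placing_rounds s) = (2 * size s)%N.
Proof. by elim: s => //= u s; rewrite /placing_rounds /= => ->; lia. Qed.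

End Rounds.

(** * Running the placing rounds in the random graph *)

Definition initial_state (S : nat) (z : nat -> nat) : state :=
  fun w => iota (w * S) (z w).

Lemma well_placed_initial (S : nat) (z : nat -> nat) :
  (forall w, z w <= S)%N -> well_placed S (initial_state S z).
Proof.
move=> zS w; split=> [|f]; first exact: iota_uniq.
rewrite mem_iota => /andP[le lt].
have lt' : (f - w * S < S)%N by have := zS w; lia.
rewrite -(subnKC le) divnMDl ?divn_small ?addn0 //; lia.
Qed.

(** There are two rounds per vertex, whence the exponent [2 * n]. If all succeed, every vertex has
    one candidate left, and these candidates form the copy. *)
Lemma finds_with_half_placing (R : realType) (V : finType) (e : rel V)
    (idx : V -> nat) (o : rel nat) (lev M : nat -> nat) (a b : nat)
    (p eps : R) (disp : measure_display) (T : measurableType disp)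
    (P : probability T R) (G : T -> rel nat) :
  let n := #|V| in
  let rounds := placing_rounds n o lev M a b (iota 0 n) in
  let z := profile n o lev M a b 0 in
  (forall w u, o w u -> u < w < n)%N ->
  injective idx -> (forall x, idx x < n)%N ->
  (forall x y, e x y -> o (idx x) (idx y) || o (idx y) (idx x)) ->
  (exists S, forall w, z w <= S)%N ->
  0 <= p <= 1 -> eps <= 1 -> low_risk p eps rounds z ->
  2^-1 <= (1 - eps) ^+ (2 * n) ->
  erdos_renyi P G p ->
  finds_with_half P G e (total_cost rounds z).
Proof.
move=> n rounds z o_lt idx_inj idx_lt eo [S zS] p01 eps1 risk half GER.
pose F := initial_state S z.
have wp : well_placed S F by exact: well_placed_initial.
have sz w : size (F w) = z w by rewrite size_iota.
exists (strategy_of (trace rounds F)).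
set Y := [set w | _].
have mY : measurable Y.
  exact: (measurable_transcript GER _ _ (copy_found e)).
suff halfY : 2^-1 <= prob P Y.
  by rewrite -[P Y]fineK ?lee_fin // fin_num_measure.
apply: le_trans half _.
have := @prob_all_succeed _ _ _ P G p GER p01 S eps rounds F z [::] Y mY eps1 wp sz.
rewrite placing_forward // uniq_placing_blocks ?iota_uniq //.
rewrite /weight big_nil mul1r size_placing_rounds size_iota.
rewrite (_ : consistent G [::] = setT); last by apply/seteqP; split.
rewrite setTI; apply=> // w _ ok; rewrite /Y /=.
have szt := size_trace ok sz.
rewrite transcript_strategy_of ?szt //; last exact: trace_nonanticipating.
rewrite -szt take_size.
have szf v := size_final ok sz v.
(* [profile n] is 1 below [n], so each of these lists has a head and the default 0 is never
   taken. *)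
pose phi x := head 0%N (final rounds F (G w) (idx x)).
have phi_in x : phi x \in final rounds F (G w) (idx x).
  have := szf (idx x); rewrite final_profile_placing // /profile idx_lt /phi.
  by case: (final _ _ _ _) => // c s _; rewrite mem_head.
exists phi; split=> [x y exy|x y exy].
  apply: idx_inj; rewrite -((wp _).2 _ (final_sub (phi_in x))).
  by rewrite exy ((wp _).2 _ (final_sub (phi_in y))).
have found x' y' : o (idx x') (idx y') ->
    ((phi y', phi x'), true) \in
      [seq (q, answer (G w) q) | q <- trace rounds F (G w)].
  move=> oxy; have [] := @final_adjacent rounds F (G w) (idx y') (idx x') _ _ ok
    (placing_forward _ _ _ _ o_lt _) _ (phi_in y') (phi_in x').
    by rewrite mem_placing_blocks // mem_iota /= idx_lt.
  by move=> gt tin; rewrite -[X in (_, X)]gt; apply: map_f.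
by case/orP: (eo _ _ exy) => /found; [right|left].
Qed.

(** * Choice of the parameters *)

Section Inequalities.
Context {R : realType}.

(** Stands in for an exponential bound: [m] independent trials all fail with probability at most 1 /
    (1 + mx). The induction rests on (1 - x)(1 + (m + 1)x) <= 1 + mx. *)
Lemma expr_compl_bound (x : R) (m : nat) : 0 <= x <= 1 ->
  (1 - x) ^+ m * (1 + m%:R * x) <= 1.
Proof.
move=> /andP[x0 x1]; elim: m => [|m IHm]; first by rewrite expr0 mul0r addr0 mul1r.
apply: le_trans IHm; rewrite exprSr -mulrA; apply: ler_wpM2l.
  by rewrite exprn_ge0 // subr_ge0.
have : 0 <= (m%:R + 1) * x ^+ 2 by rewrite mulr_ge0 ?addr_ge0 ?sqr_ge0.
by rewrite -natr1; nra.
Qed.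

Lemma bernoulli_inequality (x : R) (m : nat) : 0 <= x <= 1 ->
  1 - m%:R * x <= (1 - x) ^+ m.
Proof.
move=> /andP[x0 x1]; elim: m => [|m IHm]; first by rewrite expr0 mul0r subr0.
rewrite exprS; have h0 : 0 <= 1 - x by rewrite subr_ge0.
apply: le_trans (ler_wpM2l h0 IHm).
have : 0 <= m%:R * x ^+ 2 by rewrite mulr_ge0 ?sqr_ge0.
by rewrite -natr1; nra.
Qed.

Lemma prod_ge_expr (W : seq nat) (F : nat -> R) (y : R) : 0 <= y ->
  {in W, forall w, y <= F w} -> y ^+ size W <= \prod_(w <- W) F w.
Proof.
move=> y0; elim: W => [|w W IHW] le; first by rewrite big_nil expr0.
rewrite big_cons exprS; apply: ler_pM => //.
- exact: exprn_ge0.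
- by apply: le; rewrite mem_head.
- by apply: IHW => v vW; apply: le; rewrite inE vW orbT.
Qed.

End Inequalities.

Section Tower.
Variables (N K : nat).

(* From tower j.+1 candidates one can afford an event of probability
   (4 K tower j) ^- (N tower j). *)
Fixpoint tower (j : nat) : nat :=
  if j is i.+1 then (4 * N ^ 2 * (4 * K * tower i) ^ (N * tower i))%N else 1%N.

Lemma towerS (j : nat) :
  tower j.+1 = (4 * N ^ 2 * (4 * K * tower j) ^ (N * tower j))%N.
Proof. by []. Qed.

Hypotheses (N_gt0 : (0 < N)%N) (K_gt0 : (0 < K)%N).

Lemma tower_gt0 (j : nat) : (0 < tower j)%N.
Proof.
elim: j => // j IHj; by rewrite towerS muln_gt0 !expn_gt0 !muln_gt0 N_gt0 K_gt0 IHj.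
Qed.

Lemma towerS_ge (j : nat) : (4 * N ^ 2 * (4 * K * tower j) <= tower j.+1)%N.
Proof.
rewrite towerS leq_mul2l; apply/orP; right.
have t0 := tower_gt0 j.
rewrite -{1}[(4 * K * tower j)%N]expn1 leq_exp2l ?muln_gt0 ?N_gt0 //.
by apply: leq_trans (_ : 4 * 1 * 1 <= _)%N => //; rewrite !leq_mul.
Qed.

Lemma leq_tower (i j : nat) : (i <= j)%N -> (tower i <= tower j)%N.
Proof.
move=> ij; rewrite -(subnKC ij); elim: (j - i)%N => [|k IHk]; first by rewrite addn0.
rewrite addnS; apply: leq_trans IHk (leq_trans _ (towerS_ge _)).
have : (0 < 4 * N ^ 2)%N by rewrite muln_gt0 sqrn_gt0.
move: (4 * N ^ 2)%N (tower _) => c t c_gt0.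
by rewrite mulnA leq_pmull // muln_gt0 c_gt0 muln_gt0 K_gt0.
Qed.

End Tower.

(** Here [b] is at least [q / K], hence at least p^-1 / K, and rounding [b / t] down loses at most a
    factor 2 because [t <= b]. *)
Lemma floor_ratio_bound (R : realType) (p : R) (q K b t : nat) : 0 <= p ->
  1 <= p * q%:R -> (0 < K)%N -> (0 < t)%N -> (q <= b * K)%N -> (t <= b)%N ->
  1 <= 2 * t%:R * K%:R * ((b %/ t)%:R * p).
Proof.
move=> p0 pq K0 t0 qbK tb.
have nat_le : (q <= 2 * t * K * (b %/ t))%N.
  apply: (leq_trans qbK); rewrite mulnAC leq_mul2r; apply/orP; right.
  have := ltn_ceil b t0; rewrite mulSn => bt.
  have : (0 < b %/ t)%N by rewrite divn_gt0.
  by nia.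
apply: (le_trans pq); rewrite mulrA mulrC; apply: ler_wpM2r => //.
by move: nat_le; rewrite -(ler_nat R) !natrM.
Qed.

(** * Failure probability and cost of placing one vertex *)

Section Risk.
Context {R : realType}.
Variables (n d l : nat) (o : rel nat) (lev : nat -> nat).
Hypothesis o_lt : forall w u, o w u -> (u < w < n)%N.
Hypothesis o_lev : forall w u, o w u -> (lev u < lev w)%N.
Hypothesis lev_le : forall w, (lev w <= l)%N.
Hypothesis o_count : forall w, (count (o w) (iota 0 n) <= d)%N.
Variables (p : R) (q K b : nat).
Hypotheses (p01 : 0 <= p <= 1) (pq : 1 <= p * q%:R) (K_gt0 : (0 < K)%N).
Hypothesis qbK : (q <= b * K)%N.

Let N := n.+1.
Let M i := tower N K (l - i).
(** As [p * q] is at least 1, filtering [a] times the required number of candidates leaves on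
    average at least four times that number. *)
Let a := (4 * q)%N.
(** The [2 * n] rounds together then fail with probability below 1/2. *)
Let eps : R := (4 * N%:R)^-1.

Hypotheses (tower_b : (tower N K l <= b)%N) (b_large : (12 * N ^ 2 <= b)%N).
Hypothesis tower_q : (tower N K l <= q)%N.

Notation rnd last u := (placing_round n o lev M a b last u).
Notation prof := (profile n o lev M a b).

Let N_gt0 : (0 < N)%N. Proof. by []. Qed.
Let M_gt0 (i : nat) : (0 < M i)%N. Proof. exact: tower_gt0. Qed.
Let M_le (i : nat) : (M i <= tower N K l)%N.
Proof. by apply: leq_tower => //; apply: leq_subr. Qed.
Let q_gt0 : (0 < q)%N.
Proof. exact: leq_trans (tower_gt0 _ _ _) tower_q. Qed.
Let a_gt0 : (0 < a)%N. Proof. by rewrite muln_gt0. Qed.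

Lemma remaining_le (w u : nat) : (u <= n)%N -> (remaining n o w u <= d)%N.
Proof.
move=> un; apply: leq_trans (o_count w).
by rewrite -{2}(subnKC un) iotaD count_cat leq_addl.
Qed.

Lemma profile_target (u w : nat) : (u < n)%N -> o w u ->
  prof u w = (b * a ^ remaining n o w u.+1)%N.
Proof.
move=> un owu; have /andP[uw _] := o_lt owu.
by rewrite /profile ltnNge (ltnW uw) /= remainingS // owu.
Qed.

Lemma profile_pivot (u : nat) : prof u u = M (lev u).
Proof. by rewrite /profile ltnn (remaining_eq0 o_lt). Qed.

Lemma size_targets (last : bool) (u : nat) : (size (targets (rnd last u)) <= n)%N.
Proof.
by rewrite size_filter; apply: leq_trans (count_size _ _) _; rewrite size_iota.
Qed.

(** Split the [b] candidates of each waiting [w] into [t] blocks. A given image of [u] has a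
    neighbour in one block with probability at least [x], hence in all blocks of all [w] with
    probability at least [x ^+ (N * t)]. The tower recursion gives [u] at least [4 * N] times the
    inverse of this many candidates. *)
Lemma failure_bound_last (u : nat) : (u < n)%N ->
  failure_bound p (rnd true u) (prof u) <= eps.
Proof.
move=> un; rewrite /failure_bound [pivot _]/= profile_pivot.
have eps0 : 0 <= eps by rewrite invr_ge0 mulr_ge0.
set W := targets _.
have [->|[w0 w0W]] : W = [::] \/ exists w, w \in W.
- by case: W => [|w W]; [left | right; exists w; rewrite mem_head].
- by rewrite big_nil subrr expr0n gtn_eqF ?M_gt0.
have lev_u : (lev u < l)%N.
  have : o w0 u by move: w0W; rewrite mem_targets // => /andP[].
  by move/o_lev => h; apply: leq_trans h (lev_le _).
(* The candidate number on the level just above [u]; every waiting [w] lies on that level or higher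
   and needs at most [t] candidates. *)
pose t := tower N K (l - (lev u).+1).
have t_gt0 : (0 < t)%N by exact: tower_gt0.
have eM : M (lev u) = (4 * N ^ 2 * (4 * K * t) ^ (N * t))%N.
  by rewrite /M -(subnSK lev_u) towerS.
have tb : (t <= b)%N by apply: leq_trans tower_b; apply: leq_tower; rewrite ?leq_subr.
pose r := (b %/ t)%N.
pose y : R := 1 - (1 - p) ^+ r.
pose x : R := (4 * K * t)%:R^-1.
have ktR : 0 < (4 * K * t)%:R :> R by rewrite ltr0n !muln_gt0 K_gt0 t_gt0.
have x0 : 0 < x by rewrite invr_gt0.
(* With [s = r p >= 1 / k] and [k = 2 t K >= 2], [y] is at least s / (1 + s) >= 1 / (k + 1) >= 1 /
   (2k). *)
have xy : x <= y.
  have := expr_compl_bound r p01.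
  have /andP[p0 p1] := p01.
  have := floor_ratio_bound p0 pq K_gt0 t_gt0 qbK tb.
  rewrite -/r /y /x; set s := r%:R * p => h1 h2.
  have kt1 : 2 <= 2 * t%:R * K%:R :> R.
    by rewrite -!natrM ler_nat -mulnA leq_pmulr // muln_gt0 t_gt0.
  have e : (4 * K * t)%:R = 2 * (2 * t%:R * K%:R) :> R by rewrite !natrM; ring.
  move: kt1 h1 h2; rewrite e; set k := 2 * t%:R * K%:R; move: ((1 - p) ^+ r) => v.
  move=> k2 h1 h2.
  have s0 : 0 <= s by rewrite mulr_ge0.
  have k0 : 0 < 2 * k by lra.
  rewrite -(ler_pM2r k0) mulVf ?gt_eqF //.
  have s1 : 0 < 1 + s by lra.
  rewrite -(ler_pM2r s1).
  have h3 : 2 * k * (v * (1 + s)) <= 2 * k * 1 by apply: ler_wpM2l => //; lra.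
  have h4 : 0 <= s * (k - 1) by apply: mulr_ge0 => //; lra.
  by nra.
have y0 : 0 <= y by exact: le_trans (ltW x0) xy.
have y1 : y <= 1.
  by have /andP[p0 p1] := p01; rewrite /y gerBl exprn_ge0 // subr_ge0.
have prod_ge : x ^+ (N * t) <=
    \prod_(w <- W) binomial_tail p (prof u w) (quota (rnd true u) w).
  apply: (@le_trans _ _ ((y ^+ t) ^+ size W)).
    apply: (@le_trans _ _ (y ^+ (N * t))).
      by apply: lerXn2r; rewrite ?nnegrE // ltW.
    rewrite -exprM; apply: ler_wiXn2l => //.
    by rewrite mulnC leq_mul2r (leq_trans (size_targets _ _)) ?orbT.
  apply: prod_ge_expr; first exact: exprn_ge0.
  move=> w; rewrite mem_targets // => /andP[owu /eqP/eqP rem0].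
  rewrite profile_target //= rem0 expn0 muln1 /=.
  have Mt : (M (lev w) <= t)%N.
    by apply: leq_tower => //; apply: leq_sub2l; apply: o_lev.
  apply: (@le_trans _ _ (y ^+ M (lev w))); first exact: ler_wiXn2l.
  apply: binomial_tail_ge => //.
  by rewrite (leq_trans _ (leq_trunc_div b t)) // mulnC leq_mul2l Mt orbT.
set pi := \prod_(w <- W) _ in prod_ge *.
have pi1 : pi <= 1.
  apply: prodr_ile1 => w _; rewrite binomial_tail_ge0 //=.
  exact: binomial_tail_le1.
have pi0 : 0 <= pi by apply: le_trans prod_ge; rewrite exprn_ge0 // ltW.
have := @expr_compl_bound _ pi (M (lev u)); rewrite pi0 pi1 => /(_ isT).
have : 4 * N%:R <= (M (lev u))%:R * pi.
  apply: (@le_trans _ _ ((M (lev u))%:R * x ^+ (N * t))); last by rewrite ler_wpM2l.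
  rewrite eM natrM natrX -mulrA -exprMn divff ?gt_eqF // expr1n mulr1.
  by rewrite -natrM ler_nat leq_mul2l leq_pmulr.
have N0 : 0 < 4 * N%:R :> R by rewrite mulr_gt0 // ltr0n.
move: (M (lev u)) => m mpi; set v := (1 - pi) ^+ m => h.
have v0 : 0 <= v by rewrite exprn_ge0 // subr_ge0.
rewrite -(ler_pM2r N0) mulVf ?gt_eqF //.
by apply: le_trans h; apply: ler_wpM2l => //; lra.
Qed.

Lemma profile_after_last (u w : nat) : (u < n)%N ->
  w \in targets (rnd false u) ->
  exists2 k, remaining n o w u.+1 = k.+1 &
    update_profile (rnd true u) (prof u) w = (b * a ^ k.+1)%N.
Proof.
move=> un; rewrite mem_targets // => /andP[owu /eqP rem_neq0].
have /andP[uw _] := o_lt owu.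
case rem_eq: (remaining n o w u.+1) rem_neq0 => [//|k] _; exists k => //.
rewrite /update_profile /= (gtn_eqF uw) mem_targets // owu rem_eq /=.
by rewrite profile_target // rem_eq.
Qed.

(** The pivot has a single candidate by now, so that one must suit all targets. This is likely, as
    each target expects at least four times its quota. *)
Lemma failure_bound_rest (u : nat) : (u < n)%N ->
  failure_bound p (rnd false u) (update_profile (rnd true u) (prof u)) <= eps.
Proof.
move=> un; rewrite /failure_bound {2}/update_profile eqxx expr1.
set W := targets _.
have /andP[p0 p1] := p01.
(* The risk allowed per target: [N * delta] equals [eps]. *)
pose delta : R := (4 * N%:R ^+ 2)^-1.
have NR : 1 <= N%:R :> R by rewrite ler1n.
have delta01 : 0 <= delta <= 1.
  rewrite invr_ge0 mulr_ge0 ?exprn_ge0 //= invf_le1; first by nra.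
  by nra.
(* The exponent times [p / 2] is at least 2, which gives 1 / (1 + 2). *)
have small : (1 - p / 2) ^+ (4 * q) <= 3^-1.
  have := @expr_compl_bound _ (p / 2) (4 * q).
  have -> : 0 <= p / 2 <= 1 by apply/andP; split; lra.
  move=> /(_ isT); rewrite natrM.
  have : 0 <= (1 - p / 2) ^+ (4 * q) by rewrite exprn_ge0 //; lra.
  move: (_ ^+ _) => v v0 h.
  have pq0 : 0 <= p * q%:R - 1 by rewrite subr_ge0.
  by have := mulr_ge0 v0 pq0; lra.
have tail_ge w : w \in W -> 1 - delta <=
    binomial_tail p (update_profile (rnd true u) (prof u) w) (quota (rnd false u) w).
  move=> /(profile_after_last un)[k rem_eq ->] /=; rewrite rem_eq /=.
  set t := (b * a ^ k)%N.
  have bt : (b <= t)%N by rewrite leq_pmulr // expn_gt0 a_gt0.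
  have -> : (b * a ^ k.+1 = 4 * q * t)%N by rewrite expnS mulnCA.
  have := binomial_tail_deviation p01 (4 * q * t) t.
  rewrite exprM -exprMn.
  suff : (2 * (1 - p / 2) ^+ (4 * q)) ^+ t <= delta by lra.
  (* The base is at most 2/3 = 1 - 1/3, and 1 / (1 + t/3) is below [delta] since
     [t >= b >= 12 * N ^ 2]. *)
  apply: (@le_trans _ _ ((1 - 3^-1) ^+ t)).
    apply: lerXn2r; rewrite ?nnegrE; [|lra|lra].
    by rewrite mulr_ge0 // exprn_ge0 //; lra.
  have := @expr_compl_bound R 3^-1 t.
  have [-> ->] : 0 <= (3^-1 : R) /\ (3^-1 : R) <= 1 by split; lra.
  move=> /(_ isT).
  have : 12 * N%:R ^+ 2 <= t%:R :> R.
    by rewrite -natrX -natrM ler_nat; apply: leq_trans bt.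
  have : 0 <= (1 - 3^-1) ^+ t :> R by rewrite exprn_ge0 //; lra.
  move: (_ ^+ t) => v v0 h1 h2.
  have N0 : 0 < 4 * N%:R ^+ 2 :> R by rewrite mulr_gt0 ?exprn_gt0 //; lra.
  rewrite -(ler_pM2r N0) mulVf ?gt_eqF //.
  apply: le_trans h2; apply: ler_wpM2l => //; lra.
have delta1 : 0 <= 1 - delta by case/andP: delta01 => *; lra.
have prod_ge := prod_ge_expr delta1 tail_ge.
have := bernoulli_inequality (size W) delta01.
have : (size W)%:R * delta <= eps.
  have szW : (size W)%:R <= N%:R :> R.
    by rewrite ler_nat; apply: leq_trans (size_targets _ _) _.
  apply: (@le_trans _ _ (N%:R * delta)).
    by apply: ler_wpM2r => //; case/andP: delta01.
  rewrite /delta /eps le_eqVlt; apply/orP; left; apply/eqP; field.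
  by rewrite gt_eqF //; lra.
move: prod_ge; set pi := \prod_(w <- W) _; lra.
Qed.

Lemma cost_targets (last : bool) (u B : nat) (z : nat -> nat) :
  {in targets (rnd last u), forall w, (z w <= B)%N} ->
  (\sum_(w <- targets (rnd last u)) z w <= n * B)%N.
Proof.
move=> zB; apply: (@leq_trans (size (targets (rnd last u)) * B)%N).
  rewrite big_seq -sum1_size big_distrl /= [leqRHS]big_seq.
  by apply: leq_sum => w /zB; rewrite mul1n.
by rewrite leq_mul2r size_targets orbT.
Qed.

(** In the first round up to [tower N K l] candidates meet pools of size [b], and [2 <= d] lets
    [a ^ d.-1] absorb the tower. In the second round one candidate meets pools of size at most
    [b * a ^ d.-1]: such a target still waits for [u] and for a later vertex, which leaves an
    exponent of at most [d.-1]. *)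
Lemma placing_cost (u : nat) : (2 <= d)%N -> (u < n)%N ->
  (cost (rnd true u) (prof u) +
     cost (rnd false u) (update_profile (rnd true u) (prof u)) <=
   2 * n * b * a ^ d.-1)%N.
Proof.
move=> d2 un; have a_ge1 k : (0 < a ^ k)%N by rewrite expn_gt0 a_gt0.
have tower_a : (tower N K l <= a ^ d.-1)%N.
  apply: (leq_trans tower_q); apply: (@leq_trans a); first by rewrite leq_pmull.
  by rewrite -{1}[a]expn1 leq_pexp2l //; case: (d) d2 => [|[]].
have h1 : (cost (rnd true u) (prof u) <= a ^ d.-1 * (n * b))%N.
  rewrite /cost [pivot _]/= profile_pivot; apply: leq_mul.
    exact: leq_trans (M_le _) tower_a.
  apply: cost_targets => w; rewrite mem_targets // => /andP[owu /eqP/eqP rem0].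
  by rewrite profile_target // rem0 muln1.
have h2 : (cost (rnd false u) (update_profile (rnd true u) (prof u)) <=
    n * (b * a ^ d.-1))%N.
  rewrite /cost {1}/update_profile eqxx mul1n; apply: cost_targets => w win.
  have [k rem_eq ->] := profile_after_last un win.
  move: win; rewrite mem_targets // => /andP[owu _].
  have := remaining_le w (ltnW un); rewrite remainingS // owu rem_eq.
  by move=> kd; rewrite leq_mul2l leq_pexp2l ?orbT //; clear - kd; lia.
apply: leq_trans (leq_add h1 h2) _.
by rewrite -[leqRHS]mulnA -mulnA mulnC -mulnA addnn -mul2n.
Qed.

Lemma profile_bounded (w : nat) : (prof 0 w <= tower N K l + b * a ^ d)%N.
Proof.
rewrite /profile ltn0 /pool_size.
have := remaining_le w (leq0n n); case: (remaining n o w 0) => [_|k kd].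
  by apply: leq_trans (M_le _) _; rewrite leq_addr.
apply: leq_trans (leq_addl _ _); rewrite leq_mul2l leq_pexp2l ?orbT //.
exact: ltnW.
Qed.
End Risk.

(** * Asymptotics *)

Section Asymptotics.
Context {R : realType}.
Implicit Types (x y z : R).

Lemma iter_log_large (t : nat) z : exists2 x0 : R, 0 < x0 &
  forall x, x0 <= x -> forall i, (i <= t)%N -> z <= iter_log i x.
Proof.
elim: t z => [|t IHt] z.
  exists (Num.max 1 z) => [|x]; first by rewrite lt_max ltr01.
  by rewrite ge_max => /andP[_ zx] [|//] _.
have [x0 x0_gt0 large] := IHt (expR z).
exists x0 => // x x0x [|i] it.
  by apply: le_trans (large _ x0x 0%N isT); apply: le_trans (expR_ge1Dx z); lra.
rewrite /iter_log iterS -/(iter_log i x) -[leLHS]expRK.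
have zx : expR z <= iter_log i x by apply: large.
by rewrite ler_ln ?posrE ?expR_gt0 // (lt_le_trans (expR_gt0 z)).
Qed.

Lemma iter_log_anti (i j : nat) x : (i <= j)%N ->
  (forall k, (k <= j)%N -> 1 <= iter_log k x) -> iter_log j x <= iter_log i x.
Proof.
move=> ij large; rewrite -(subnKC ij).
have : (i + (j - i) <= j)%N by rewrite subnKC.
elim: (j - i)%N => [|k IHk] kj; first by rewrite addn0.
rewrite addnS; apply: le_trans (IHk _); last by lia.
rewrite {1}/iter_log iterS -/(iter_log (i + k) x).
have l0 : 0 < iter_log (i + k) x by apply: lt_le_trans (large _ _) => //; lia.
by have := ln_sublinear l0; lra.
Qed.

(** One tower step costs one exponential. With v the fourth root of [z], [K <= v ^+ 4] and
    [t <= v ^+ 2], so the logarithm of the squared step is of order N^2 v^3, which v^4 = [z]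
    dominates. *)
Lemma tower_step (N K t : nat) z : (0 < N)%N ->
  (26 * N%:R ^+ 2) ^+ 4 <= z -> K%:R <= z -> t%:R ^+ 2 <= z ->
  (4 * N ^ 2 * (4 * K * t) ^ (N * t))%:R ^+ 2 <= expR z.
Proof.
move=> N_gt0 z_large Kz tz.
have N1 : 1 <= N%:R :> R by rewrite ler1n.
pose u := Num.sqrt z; pose v := Num.sqrt u.
have z0 : 0 <= z by apply: le_trans tz; apply: sqr_ge0.
have u0 : 0 <= u by apply: sqrtr_ge0.
have v0 : 0 <= v by apply: sqrtr_ge0.
have vu : v ^+ 2 = u by rewrite sqr_sqrtr.
have vz : v ^+ 4 = z by rewrite (exprM v 2 2) vu sqr_sqrtr.
have vN : 26 * N%:R ^+ 2 <= v.
  by rewrite -(@ler_pXn2r _ 4) ?nnegrE // ?vz // mulr_ge0 // exprn_ge0.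
have tu : t%:R <= v ^+ 2.
  by rewrite vu -(@ler_pXn2r _ 2) ?nnegrE // sqr_sqrtr.
have exp_ge (x : R) : x <= expR x by have := expR_ge1Dx x; lra.
have h1 : (4 * N ^ 2)%:R <= expR (4 * N%:R ^+ 2) :> R by rewrite natrM natrX.
have h2 : (4 * K * t)%:R <= expR (3 + 6 * v).
  rewrite !natrM (_ : 3 + 6 * v = 3 + 4%:R * v + 2%:R * v); last by ring.
  rewrite (expRD (3 + _)) (expRD 3 (_ * _)) !expRM_natl; apply: ler_pM; rewrite ?mulr_ge0 //.
    apply: ler_pM => //; first by have := expR_ge1Dx (3 : R); lra.
    by apply: le_trans Kz _; rewrite -vz; apply: lerXn2r; rewrite ?nnegrE ?expR_ge0.
  by apply: le_trans tu _; apply: lerXn2r; rewrite ?nnegrE ?expR_ge0.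
have h3 : (4 * K * t)%:R ^+ (N * t) <= expR ((3 + 6 * v) * (N%:R * v ^+ 2)).
  apply: (@le_trans _ _ (expR (3 + 6 * v) ^+ (N * t))).
    by apply: lerXn2r; rewrite ?nnegrE ?expR_ge0.
  rewrite -expRM_natl ler_expR natrM mulrC; apply: ler_wpM2l; first by lra.
  by apply: ler_wpM2l => //; lra.
rewrite natrM natrX.
apply: (@le_trans _ _
    ((expR (4 * N%:R ^+ 2) * expR ((3 + 6 * v) * (N%:R * v ^+ 2))) ^+ 2)).
  apply: lerXn2r; rewrite ?nnegrE ?mulr_ge0 ?expR_ge0 ?exprn_ge0 //.
  by apply: ler_pM; rewrite ?exprn_ge0.
rewrite -expRD -expRM_natl ler_expR -vz.
have v1 : 1 <= v by nra.
move: (N%:R) N1 vN => m m1 mv.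
have hm : m <= m ^+ 2 by nra.
have v2 : 1 <= v ^+ 2 by nra.
have v3 : v ^+ 2 <= v ^+ 3 by rewrite exprS; nra.
have m2 : 1 <= m ^+ 2 by nra.
have e1 : m ^+ 2 <= m ^+ 2 * v ^+ 3 by nra.
have e2 : m * v ^+ 2 <= m ^+ 2 * v ^+ 3 by apply: ler_pM => //; nra.
have e3 : m * v ^+ 3 <= m ^+ 2 * v ^+ 3 by apply: ler_wpM2r => //; rewrite exprn_ge0.
(* The 26 is 8 + 6 + 12, the sum of the coefficients in the exponent below. *)
have e4 : 26 * m ^+ 2 * v ^+ 3 <= v * v ^+ 3 by apply: ler_wpM2r; rewrite ?exprn_ge0.
have -> : v ^+ 4 = v * v ^+ 3 by rewrite -exprS.
have -> : 2%:R * (4 * m ^+ 2 + (3 + 6 * v) * (m * v ^+ 2)) =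
  8 * m ^+ 2 + 6 * (m * v ^+ 2) + 12 * (m * v ^+ 3) by ring.
by lra.
Qed.

Lemma tower_iter_log (N l : nat) : (0 < N)%N -> exists2 x0 : R, 0 < x0 &
  forall x, x0 <= x ->
    [/\ 1 <= iter_log l x, 1 <= iter_log l.+1 x
      & (tower N (Num.truncn (iter_log l x)) l)%:R ^+ 2 <= x].
Proof.
move=> N_gt0.
have [x0 x0_gt0 large] := iter_log_large l.+1 ((26 * N%:R ^+ 2) ^+ 4 : R).
exists x0 => // x /large {}large.
have big1 : 1 <= (26 * N%:R ^+ 2) ^+ 4 :> R.
  rewrite exprn_ege1 //; have : 1 <= N%:R :> R by rewrite ler1n.
  by nra.
have large1 k : (k <= l.+1)%N -> 1 <= iter_log k x.
  by move=> kl; apply: le_trans big1 (large _ kl).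
split; [by apply: large1 | by apply: large1 |].
set K := Num.truncn _.
have K_le : K%:R <= iter_log l x by rewrite truncn_le (le_trans _ (large1 l _)).
(* Each tower step undoes one logarithm, so the square of [tower N K j] stays below the iterated
   logarithm with [j] logarithms fewer than [l]. *)
suff gen j : (j <= l)%N -> (tower N K j)%:R ^+ 2 <= iter_log (l - j) x.
  by have := gen l (leqnn l); rewrite subnn.
elim: j => [|j IHj] jl; first by rewrite expr1n subn0 large1.
have lj : (l - j = (l - j.+1).+1)%N by rewrite subnSK.
have y0 : 0 < iter_log (l - j.+1) x.
  by apply: lt_le_trans (large1 _ _) => //; lia.
have e : expR (iter_log (l - j) x) = iter_log (l - j.+1) x.
  by rewrite lj {1}/iter_log iterS -/(iter_log _ _) lnK // posrE.
rewrite towerS -e; apply: tower_step => //.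
- by apply: large; lia.
- apply: le_trans K_le _; apply: iter_log_anti; first by lia.
  by move=> k kl; apply: large1; lia.
- by apply: IHj; lia.
Qed.

End Asymptotics.

(** * The bound for explicit parameters and its asymptotic form *)

Lemma query_number_placing (R : realType) (V : finType) (e O : rel V)
    (d l : nat) (p : R) (q K : nat) (disp : measure_display)
    (T : measurableType disp) (P : probability T R) (G : T -> rel nat) :
  let n := #|V| in let b := (q %/ K).+1 in
  orientation e O -> acyclic O -> max_outdegree_le O d ->
  directed_paths_le O l -> (2 <= d)%N -> (1 <= l)%N ->
  0 <= p <= 1 -> 1 <= p * q%:R -> (0 < K)%N ->
  (tower n.+1 K l ^ 2 <= q)%N -> erdos_renyi P G p ->
  (query_number P G e <= (n * (2 * n * b * (4 * q) ^ d.-1))%:R%:E)%E.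
Proof.
move=> n b eO ac dO short d2 l1 p01 pq K_gt0 tq GER.
set N := n.+1.
have [idx [ o [lev [idx_inj idx_lt eo o_props [lev_le o_count]]]]] :=
  topological_order eO ac dO short.
have o_lt w u : o w u -> (u < w < n)%N by move=> /o_props/and3P[-> ->].
have o_lev w u : o w u -> (lev u < lev w)%N by move=> /o_props/and3P[].
have qbK : (q <= b * K)%N by apply/ltnW/ltn_ceil.
(* As [1 <= l], the tower is at least its first value 4 N^2 (4K)^N. *)
have tower_large : (16 * N ^ 2 * K <= tower N K l)%N.
  apply: leq_trans (leq_tower (isT : 0 < N)%N K_gt0 l1).
  by rewrite (leq_trans _ (towerS_ge _ _ _)) //= muln1; lia.
have t_gt0 : (0 < tower N K l)%N by apply: tower_gt0.
(* The square in the hypothesis pays for the factor [K]: tower times [K] is at most the squared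
   tower, hence at most [q <= b * K]. *)
have tower_b : (tower N K l <= b)%N.
  have : (tower N K l * K <= b * K)%N.
    apply: leq_trans qbK; apply: leq_trans tq; rewrite -mulnn leq_mul2l.
    apply/orP; right; apply: leq_trans tower_large.
    by rewrite leq_pmull // muln_gt0 sqrn_gt0.
  by rewrite leq_pmul2r.
have tower_q : (tower N K l <= q)%N.
  by apply: leq_trans tq; rewrite -mulnn leq_pmulr.
have b_large : (12 * N ^ 2 <= b)%N.
  apply: leq_trans tower_b; apply: leq_trans tower_large.
  by apply: (@leq_trans (16 * N ^ 2)%N); rewrite ?leq_mul2r ?orbT ?leq_pmulr.
pose eps : R := (4 * N%:R)^-1.
pose M i := tower N K (l - i).
have NR : 1 <= N%:R :> R by rewrite ler1n.
have eps01 : 0 <= eps <= 1.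
  by apply/andP; split; [rewrite invr_ge0 | rewrite invf_le1]; lra.
have := @finds_with_half_placing R V e idx o lev M (4 * q) b p eps disp T P G
  o_lt idx_inj idx_lt eo.
set cst := total_cost _ _ => finds.
have cst_le : (cst <= n * (2 * n * b * (4 * q) ^ d.-1))%N.
  apply: total_cost_placing => // u un.
  exact: (placing_cost lev o_lt o_count b K_gt0 tower_q d2 un).
apply: (@le_trans _ _ (cst%:R%:E)); last by rewrite lee_fin ler_nat.
apply: ereal_inf_lbound; exists cst => //; apply: finds => //.
- by exists (tower N K l + b * (4 * q) ^ d)%N => w; exact: (profile_bounded lev o_count b K_gt0 tower_q).
- by case/andP: eps01.
- apply: low_risk_placing => // u un; split.
    exact: (failure_bound_last o_lt o_lev lev_le p01 pq K_gt0 qbK tower_b).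
  exact: (failure_bound_rest lev o_lt p01 pq K_gt0 b_large tower_q).
apply: le_trans (bernoulli_inequality _ eps01).
rewrite /eps -/n natrM.
have nN : n%:R = N%:R - 1 :> R by rewrite /N -natr1; ring.
have : 2 * n%:R * (4 * N%:R)^-1 <= 2^-1 :> R.
  by rewrite ler_pdivrMr; lra.
lra.
Qed.

(** Since (q %/ K) + 1 is at most 2q / K, the cost is at most n^2 (4q)^d / K. Then 4q <= 8 p^-1 and
    1 / K <= 2 / L give the constant, and [1 <= L'] brings in the remaining factor. *)
Lemma query_bound_estimate (R : realType) (n d q K : nat) (p L L' : R) :
  (0 < d)%N -> 0 < p -> q%:R <= 2 * p^-1 -> (0 < K)%N -> (K <= q)%N ->
  0 < L -> L <= 2 * K%:R -> 1 <= L' ->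
  (n * (2 * n * (q %/ K).+1 * (4 * q) ^ d.-1))%:R <=
    2 * n%:R ^+ 2 * 8 ^+ d * (p ^- d * L' / L).
Proof.
move=> d_gt0 p0 q2 K_gt0 Kq L0 LK L1.
have bK : ((q %/ K).+1 * K <= 2 * q)%N.
  by rewrite mulSn mul2n -addnn leq_add // leq_trunc_div.
set b := (q %/ K).+1 in bK *.
have KR : 0 < K%:R :> R by rewrite ltr0n.
have nat_le : (n * (2 * n * b * (4 * q) ^ d.-1) * K <= n ^ 2 * (4 * q) ^ d)%N.
  rewrite -[in leqRHS](prednK d_gt0) (expnS (4 * q)).
  move: ((4 * q) ^ d.-1)%N => m.
  rewrite -mulnn; have := leq_mul (leqnn (n * n * (2 * m))) bK; lia.
have p_d : 0 < p ^- d by rewrite invr_gt0 exprn_gt0.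
have q_le : (4 * q%:R) ^+ d <= 8 ^+ d * p ^- d :> R.
  rewrite -exprVn -exprMn; apply: lerXn2r; rewrite ?nnegrE ?mulr_ge0 ?invr_ge0 ?(ltW p0) //.
  by lra.
apply: (@le_trans _ _ (n%:R ^+ 2 * (8 ^+ d * p ^- d) / K%:R)).
  rewrite ler_pdivlMr // -natrM; move: nat_le; rewrite -(ler_nat R).
  move=> /le_trans; apply; rewrite natrM !natrX natrM.
  by apply: ler_wpM2l; rewrite ?exprn_ge0.
have -> : 2 * n%:R ^+ 2 * 8 ^+ d * (p ^- d * L' / L) =
    n%:R ^+ 2 * (8 ^+ d * p ^- d) * (2 * L' / L) by ring.
apply: ler_wpM2l.
  by rewrite mulr_ge0 ?exprn_ge0 // mulr_ge0 ?exprn_ge0 // ltW.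
rewrite ler_pdivlMr // mulrC ler_pdivrMr //.
by apply: (le_trans LK); apply: ler_wpM2r; [exact: ltW | lra].
Qed.

Theorem theorem1 (R : realType) (V : finType) (e : rel V) (d Delta : nat)
    (He : simple_graph e) (Hd : is_degeneracy e d) (HDelta : is_depth e d Delta)
    (d_ge2 : (2 <= d)%N) (Delta_ge1 : (1 <= Delta)%N) :
  exists C : R, \forall p \near (0 : R)^'+,
    forall (disp : measure_display) (T : measurableType disp)
           (P : probability T R) (G : T -> rel nat),
      erdos_renyi P G p ->
      (query_number P G e <=
       (C * (p ^- d * iter_log Delta.+1 p^-1 / iter_log Delta p^-1))%:E)%E.
Proof.
have [[ O [eO ac dO short]] _] := HDelta.
have [x0 x0_gt0 large] := @tower_iter_log R #|V|.+1 Delta isT.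
exists (2 * #|V|%:R ^+ 2 * 8 ^+ d).
near=> p => disp T P G GER.
have p0 : 0 < p by near: p; exact: nbhs_right_gt.
have p1 : p < 1 by near: p; exact: nbhs_right_lt.
have px0 : p < x0^-1 by near: p; apply: nbhs_right_lt; rewrite invr_gt0.
have xp : x0 <= p^-1.
  by rewrite -[x0]invrK lef_pV2 ?posrE ?invr_gt0 // ltW.
have [L1 L2 towerL] := large _ xp.
set L := iter_log Delta p^-1 in L1 towerL *.
(* [K] rounds the iterated logarithm down, and [q] is the least integer above p^-1, so that [p * q]
   is at least 1 while [q] is at most 2 p^-1. *)
pose K := Num.truncn L; pose q := (Num.truncn p^-1).+1.
have pV1 : 1 <= p^-1 by rewrite invf_ge1 // ltW.
have /andP[q1 q2] : (Num.truncn p^-1)%:R <= p^-1 < q%:R.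
  by apply: truncn_itv; rewrite invr_ge0 ltW.
have /andP[K1 K2] : K%:R <= L < K.+1%:R by apply: truncn_itv; lra.
have K_gt0 : (0 < K)%N by rewrite truncn_gt0.
have tq : (tower #|V|.+1 K Delta ^ 2 <= q)%N.
  by rewrite -(ler_nat R) natrX; apply: le_trans towerL (ltW q2).
have Kq : (K <= q)%N.
  apply: leq_trans tq; rewrite -mulnn.
  have := leq_trans (@towerS_ge #|V|.+1 K isT K_gt0 0)
    (@leq_tower #|V|.+1 K isT K_gt0 _ _ Delta_ge1).
  by rewrite [tower _ _ 0]/=; move: (tower _ _ _) => t; nia.
have pq : 1 <= p * q%:R by rewrite -[leLHS](mulfV (lt0r_neq0 p0)) ler_pM2l ?ltW.
have p01 : 0 <= p <= 1 by apply/andP; split; apply: ltW.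
apply: le_trans (query_number_placing eO ac dO short d_ge2 Delta_ge1 p01 pq
  K_gt0 tq GER) _.
rewrite lee_fin; apply: query_bound_estimate => //.
- exact: ltnW.
- by rewrite /q -natr1; lra.
- by lra.
- have : 1 <= K%:R :> R by rewrite ler1n.
  by move: K2; rewrite -natr1; lra.
Unshelve. all: by end_near.
Qed.
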